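(* Fix a relational signature $\tau$ and a set $V$ of variables, and let $q$ be a non-zero component polynomial. Then there exists a finite structure $\mathbf{B}$ such that $q\llbracket\mathbf{B}\rrbracket\neq0$. Moreover, if $\phi_1(S_1),\dots,\phi_n(S_n)$ are representatives of the equivalence classes $e_1,\dots,e_n\in\mathcal{E}$ whose variables $X_{e_i}$ appear in $q$, and $\mathbf{A}$ is any finite $\tau$-structure with $|\phi_i(\mathbf{A})|>0$ for all $i\in[n]$, then $\mathbf{B}$ may be chosen of the form $\mathbf{A}\times\mathbf{E}$, where $\mathbf{E}$ is a finite $\tau$-structure with $|\phi(\mathbf{E})|>0$ for every pp-formula $\phi$ over $\tau$.
   Context: Structures are finite relational $\tau$-structures, no equality. A pp-formula is built from atoms using $\wedge,\exists$; a prenex pp-formula with liberal variables $S$ is identified with a pair $(\mathbf{A},S)$ (universe: $S$ plus the formula's variables; $R^{\mathbf{A}}$ = tuples forming atoms; variables outside $S$ existentially quantified), and $\phi(\mathbf{B})$ is the set of maps $S\to B$ extending to a homomorphism $\mathbf{A}\to\mathbf{B}$. Its graph has vertex set $A\cup S$ with edges between vertices co-occurring in a tuple; it is connected if the graph is connected, liberal if $S\neq\emptyset$. Two such formulas are counting equivalent if they have the same number of satisfying assignments on every finite structure. $\mathcal{E}$ denotes the set of counting equivalence classes of liberal connected prenex pp-formulas over $\tau$ with liberal variables from $V$. A component polynomial is a multivariate polynomial with integer coefficients in variables $\{X_e : e\in\mathcal{E}\}$; its value $q\llbracket\mathbf{B}\rrbracket$ on a finite structure $\mathbf{B}$ is obtained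 by substituting $|\phi_e(\mathbf{B})|$ for each $X_e$, where $\phi_e\in e$. The product $\mathbf{A}\times\mathbf{E}$ has universe $A\times E$ and $R^{\mathbf{A}\times\mathbf{E}}=\{((a_1,e_1),\dots,(a_k,e_k)) : (a_i)\in R^{\mathbf{A}},(e_i)\in R^{\mathbf{E}}\}$.
   Formalization: All relation symbols of the signature are assumed to have arity at least 1; with a nullary symbol P, the non-zero polynomial X_P^2 - X_P X_true (one liberal variable x, with atom P() or with no atom) vanishes on every finite structure. *)

(* Defs.v *)
From HB Require Import structures.
From mathcomp Require Import all_boot all_algebra finmap boolp.
From mathcomp Require Import monalg.

Set Implicit Arguments.
Unset Strict Implicit.
Unset Printing Implicit Defensive.

Import GRing.Theory.

Local Open Scope quotient_scope.
Local Open Scope fset_scope.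

(* Arities are positive. With a nullary symbol P, the inequivalent formulas
   "true" and P, both with the single liberal variable x, would satisfy
   X_P ^+ 2 = X_P * X_true on every structure. *)
Record signature := Signature {
  symbol :> choiceType;
  arity : symbol -> nat;
  arity_gt0 : forall R : symbol, (0 < arity R)%N }.

Record structure (tau : signature) := Structure {
  universe :> finType;
  interp : forall R : tau, {set (arity R).-tuple universe} }.

Section Structures.
Variable tau : signature.

Definition homomorphism (A B : structure tau) (h : A -> B) : Prop :=
  forall (R : tau) (t : (arity R).-tuple A),
    t \in interp A R -> [tuple of map h t] \in interp B R.

Definition product (A E : structure tau) : structure tau :=
  Structure (universe := (A * E)%type) (fun R : tau =>
    [set t : (arity R).-tuple (A * E)%type |
      ([tuple of map fst t] \in interp A R) &&
      ([tuple of map snd t] \in interp E R)]).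

Definition gaifman (A : structure tau) : rel A := fun x y =>
  (x != y) && `[< exists (R : tau) (t : (arity R).-tuple A),
                    [/\ t \in interp A R, x \in t & y \in t] >].

Definition connected (A : structure tau) : Prop :=
  forall x y : A, connect (@gaifman A) x y.

End Structures.

Section Formulas.
Variables (tau : signature) (X : choiceType).

Inductive pp_formula : Type :=
  | PPTrue (* the empty conjunction *)
  | PPAtom (R : tau) (t : (arity R).-tuple X)
  | PPAnd (phi psi : pp_formula)
  | PPEx (x : X) (phi : pp_formula).

Fixpoint free_vars (phi : pp_formula) : {fset X} :=
  match phi with
  | PPTrue => fset0
  | PPAtom _ t => [fset x in val t]
  | PPAnd phi psi => free_vars phi `|` free_vars psi
  | PPEx x phi => free_vars phi `\ x
  end.

(* Assignments are partial, so that the empty structure is treated properly. *)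
Fixpoint pp_sat (B : structure tau) (g : X -> option B) (phi : pp_formula) :
    Prop :=
  match phi with
  | PPTrue => True
  | PPAtom R t => exists2 b : (arity R).-tuple B,
      b \in interp B R & map g t = map Some b
  | PPAnd phi psi => pp_sat g phi /\ pp_sat g psi
  | PPEx x phi =>
      exists b : B, pp_sat (fun y => if y == x then Some b else g y) phi
  end.

(* [phi(B)] when [S], containing the free variables of [phi], is its set of
   liberal variables. *)
Definition pp_answers (S : {fset X}) (phi : pp_formula) (B : structure tau) :
    {set {ffun S -> B}} :=
  [set f : {ffun S -> B} |
    `[< pp_sat (fun x => omap f (insub x : option S)) phi >]].

(* The pair (A, S): [prenex_tuples] lists the tuples of all the relations of A,
   so that there are finitely many of them even if the signature is infinite. *)
Record prenex_pp := PrenexPP {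
  prenex_vars : {fset X};
  prenex_tuples : {fset {R : tau & (arity R).-tuple prenex_vars}};
  prenex_lib : {set prenex_vars} }.

HB.instance Definition _ := gen_eqMixin prenex_pp.
HB.instance Definition _ := gen_choiceMixin prenex_pp.

Definition prenex_structure (phi : prenex_pp) : structure tau :=
  Structure (universe := prenex_vars phi) (fun R : tau =>
    [set t | Tagged (fun R : tau => (arity R).-tuple (prenex_vars phi)) t
               \in prenex_tuples phi]).

Definition answers (phi : prenex_pp) (B : structure tau) :
    {set {ffun {x | x \in prenex_lib phi} -> B}} :=
  [set f : {ffun {x | x \in prenex_lib phi} -> B} |
    `[< exists2 h : prenex_structure phi -> B,
          homomorphism h & forall x, h (val x) = f x >]].

Definition counting_equivalent (phi psi : prenex_pp) : Prop :=
  forall B : structure tau, #|answers phi B| = #|answers psi B|.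

Definition liberal_connected (V : {pred X}) : pred prenex_pp := fun phi =>
  [&& prenex_lib phi != set0,
      `[< connected (prenex_structure phi) >] &
      [forall x in prenex_lib phi, val x \in V]].

End Formulas.

Section ComponentPolynomials.
Variables (tau : signature) (X : choiceType) (V : {pred X}).

Definition lc_formula : choiceType :=
  {phi : prenex_pp tau X | liberal_connected V phi}.

Definition lc_equiv : rel lc_formula := fun phi psi =>
  `[< counting_equivalent (val phi) (val psi) >].

Lemma lc_equiv_refl : reflexive lc_equiv.
Proof. by move=> phi; apply/asboolP. Qed.

Lemma lc_equiv_sym : symmetric lc_equiv.
Proof. by move=> phi psi; apply/asboolP/asboolP => eqv B; rewrite eqv. Qed.

Lemma lc_equiv_trans : transitive lc_equiv.
Proof.
move=> psi phi chi /asboolP eqv1 /asboolP eqv2.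
by apply/asboolP => B; rewrite eqv1 eqv2.
Qed.

Canonical lc_equivR :=
  EquivRel lc_equiv lc_equiv_refl lc_equiv_sym lc_equiv_trans.

Definition eclass : choiceType := {eq_quot lc_equivR}.

Definition class_of (phi : lc_formula) : eclass := \pi_{eq_quot lc_equivR} phi.

Definition component_poly := {malg int[{cmonom eclass}]}.

Definition cp_vars (q : component_poly) : {fset eclass} :=
  [fset e | m in msupp q, e in finsupp (cmonom_val m)].

Definition eclass_count (e : eclass) (B : structure tau) : nat :=
  #|answers (val (repr (e : {eq_quot lc_equivR}))) B|.

Lemma eclass_countE (phi : lc_formula) (B : structure tau) :
  eclass_count (class_of phi) B = #|answers (val phi) B|.
Proof.
have /eqmodP/asboolP eqv :
    repr (class_of phi) = phi %[mod {eq_quot lc_equivR}] by rewrite reprK.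
exact: eqv.
Qed.

Definition cp_eval (q : component_poly) (B : structure tau) : int :=
  mmap idfun (fun m : {cmonom eclass} =>
    \prod_(e <- finsupp (cmonom_val m)) (eclass_count e B)%:Z ^+ m e)%R q.

End ComponentPolynomials.

(* Main.v *)
Require Import Defs.
From mathcomp Require Import all_boot all_algebra finmap boolp.
From mathcomp Require Import monalg ring.

(** Counts of liberal connected formulas are additive on disjoint unions and
multiplicative on products. Suppose that [q] vanishes on [A * E] for all [E]
with a looped point. Polynomiality in the multiplicity of a summand shows that
[q] then vanishes on [A] times any difference of two count vectors. These
differences form a ring which separates the variables of [q], and hence
contains a nonzero multiple of each coordinate vector; so a nonzero polynomial
would vanish on a full-rank sublattice of its integer points. *)

Set Implicit Arguments.
Unset Strict Implicit.
Unset Printing Implicit Defensive.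

Import GRing.Theory Num.Theory.

Local Open Scope ring_scope.
Local Open Scope fset_scope.

(** * Integer polynomials: uniqueness of digits and points of non-vanishing *)

Section IntegerPolynomials.

Lemma poly_int_nat_roots (p : {poly int}) :
  (forall n : nat, p.[n%:Z] = 0) -> p = 0.
Proof.
move=> p0; apply: (@roots_geq_poly_eq0 _ _ [seq k%:Z | k <- iota 0 (size p)]).
- by apply/allP => _ /mapP[k _ ->]; apply/rootP.
- by rewrite map_inj_uniq ?iota_uniq // => k l [].
- by rewrite size_map size_iota.
Qed.

(** Uniqueness of base-[D] expansions, with the digit of [x] at position [index x s]: the digit of
    the head is the residue modulo [D], and the quotient by [D] is the expansion along the tail. *)
Lemma digits_inj (T : eqType) (D : nat) (s : seq T) (a b : T -> nat) :
    uniq s -> {in s, forall x, (a x < D)%N} -> {in s, forall x, (b x < D)%N} ->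
    (\sum_(x <- s) a x * D ^ index x s = \sum_(x <- s) b x * D ^ index x s)%N ->
  {in s, a =1 b}.
Proof.
elim: s => [|y s IHs] //= /andP[ys us] aD bD.
have shift (c : T -> nat) : (\sum_(x <- y :: s) c x * D ^ index x (y :: s) =
    (\sum_(x <- s) c x * D ^ index x s) * D + c y)%N.
  rewrite big_cons /= eqxx muln1 addnC big_distrl /=; congr addn.
  apply: eq_big_seq => x xs; case: eqP => [yx|_]; first by rewrite yx xs in ys.
  by rewrite expnSr mulnA.
have yD (c : T -> nat) : {in y :: s, forall x, (c x < D)%N} -> (c y < D)%N.
  by apply; rewrite mem_head.
rewrite !shift => /eqP.
have /IHs IH : {in s, forall x, (a x < D)%N}.
  by move=> x xs; apply: aD; rewrite inE xs orbT.
have bD' : {in s, forall x, (b x < D)%N}.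
  by move=> x xs; apply: bD; rewrite inE xs orbT.
move=> /eqP eqab.
have D0 : (0 < D)%N by apply: leq_trans (yD _ aD).
have eqy : a y = b y.
  by have := congr1 (modn^~ D) eqab; rewrite /= !modnMDl !modn_small ?yD.
move=> x; rewrite inE => /predU1P[->//|]; apply: IH => //.
by move: eqab => /eqP; rewrite eqy eqn_add2r eqn_pmul2r // => /eqP.
Qed.

Variable I : choiceType.
Implicit Types q : {malg int[{cmonom I}]}.

(** The ring is left free because [q] is evaluated both at integers and at univariate polynomials in
    a parameter. *)
Definition meval (R : comNzRingType) q (x : I -> R) : R :=
  \sum_(m <- msupp q) (q@_m)%:~R *
    \prod_(i <- finsupp (cmonom_val m)) x i ^+ m i.

Lemma eq_meval (R : comNzRingType) q (x y : I -> R) :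
  (forall m i, m \in msupp q -> i \in finsupp (cmonom_val m) -> x i = y i) ->
  meval q x = meval q y.
Proof.
move=> eqxy; apply: eq_big_seq => m mq; congr (_ * _).
by apply: eq_big_seq => i im; rewrite (eqxy m).
Qed.

Lemma horner_meval q (p : I -> {poly int}) (t : int) :
  (meval q p).[t] = meval q (fun i => (p i).[t]).
Proof.
rewrite /meval horner_sum; apply: eq_bigr => m _.
rewrite hornerM horner_prod; congr (_ * _).
  by rewrite -(rmorph_int (@polyC int)) hornerC.
by apply: eq_bigr => i _; rewrite horner_exp.
Qed.

(* Kronecker substitution: a large base [D] keeps distinct monomials apart. *)
Lemma meval_neq0 q (s : {fset I}) (c : I -> int) : q != 0 ->
    {in msupp q, forall m, finsupp (cmonom_val m) `<=` s} ->
    {in s, forall i, c i != 0} ->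
  exists x : I -> int, meval q (fun i => c i * x i) != 0.
Proof.
(* [D] exceeds every exponent of a variable of [s] in [q], so the exponents of a monomial are the
   base-[D] digits of its degree [w m] after substitution. *)
move=> q0 qs c0; pose D := (\max_(m <- msupp q) \max_(i <- s) m i).+1.
have mD m i : m \in msupp q -> i \in s -> (m i < D)%N.
  move=> mq is_; rewrite ltnS (leq_trans _ (leq_bigmax_seq _ mq _)) //.
  exact: (leq_bigmax_seq (F := fun i => m i)).
pose w (m : {cmonom I}) := (\sum_(i <- s) m i * D ^ index i s)%N.
pose P := meval q (fun i => (c i)%:P * 'X^(D ^ index i s)).
(* The scalars [c i] only change the coefficients, and nonzero scalars keep these nonzero. *)
pose b m := q@_m * \prod_(i <- s) c i ^+ m i.
have PE : P = \sum_(m <- msupp q) (b m)%:P * 'X^(w m).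
  apply: eq_big_seq => m mq; rewrite /b polyCM -mulrA; congr (_ * _).
    by rewrite -(rmorph_int (@polyC int)) intz.
  rewrite (big_fset_incl _ (qs _ mq)) /=; last first.
    by move=> i _; rewrite -cmE_eq0 => /eqP ->; rewrite expr0.
  rewrite rmorph_prod /w expr_sum -big_split /=; apply: eq_bigr => i _.
  by rewrite exprMn rmorphXn /= -exprM mulnC.
have P0 : P != 0.
  have [m0 m0q] : exists m, m \in msupp q.
    by apply/fset0Pn; rewrite msupp_eq0.
  apply/eqP => /(congr1 (fun p : {poly int} => p`_(w m0))).
  rewrite coef0 PE coef_sum (big_fsetD1 m0) //= coefCM coefXn eqxx mulr1.
  rewrite big_seq big1 ?addr0 => [|m].
    apply/eqP; rewrite mulf_neq0 ?mcoeff_neq0 //.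
    by rewrite prodf_seq_neq0; apply/allP => i /c0; apply: expf_neq0.
  rewrite in_fsetD1 => /andP[mm0 mq]; rewrite coefCM coefXn.
  (* Another monomial of the same degree would have the same digits, hence the same exponents on
     [s]; off [s] both have exponent 0. *)
  case: eqP => [/esym eqw|_]; last by rewrite mulr0.
  case/eqP: mm0; apply/eqP/cmP => i; have [is_|si] := boolP (i \in s).
    by apply: (digits_inj _ _ _ eqw) => // j js; apply: mD.
  have out m' : m' \in msupp q -> m' i = 0%N.
    move=> m'q; apply/eqP; rewrite cmE_eq0.
    by apply/negP => /(fsubsetP (qs _ m'q)); apply/negP.
  by rewrite !out.
have [t Pt] : exists t : nat, P.[t%:Z] != 0.
  apply: contrapT => /forallNP Pt; case/eqP: P0; apply: poly_int_nat_roots => t.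
  by apply/eqP/negPn/negP/Pt.
exists (fun i => t%:Z ^+ (D ^ index i s)).
rewrite horner_meval in Pt; move: Pt; congr (_ != _); apply: eq_meval => m i _ _.
by rewrite hornerCM hornerXn.
Qed.

End IntegerPolynomials.

(** * Disjoint unions, looped points and connectedness *)

Section StructureOperations.
Variable tau : signature.
Implicit Types A B C : structure tau.

Lemma interp_val B (R : tau) (s t : (arity R).-tuple B) :
  val s = val t -> s \in interp B R -> t \in interp B R.
Proof. by move=> /val_inj ->. Qed.

Definition sum_structure B C : structure tau :=
  Structure (universe := (B + C)%type) (fun R : tau =>
    map_tuple inl @: interp B R :|: map_tuple inr @: interp C R).

Definition loop_structure : structure tau :=
  Structure (universe := unit) (fun R : tau => [set: (arity R).-tuple unit]).

(** Sending all variables, free or quantified, to such a point satisfies every pp-formula; this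
    secures the positivity demanded of [E]. *)
Definition has_loop B : Prop :=
  exists b : B, forall R : tau, [tuple of nseq (arity R) b] \in interp B R.

Lemma has_loop_loop : has_loop loop_structure.
Proof. by exists tt => R; rewrite inE. Qed.

Lemma has_loop_sumr B C : has_loop C -> has_loop (sum_structure B C).
Proof.
case=> c loop_c; exists (inr c) => R; rewrite inE; apply/orP; right.
apply/imsetP; exists [tuple of nseq (arity R) c]; first exact: loop_c.
by apply: val_inj; rewrite /= map_nseq.
Qed.

Lemma pp_sat_loop (X : choiceType) B (b : B) (phi : pp_formula tau X) g :
    (forall R : tau, [tuple of nseq (arity R) b] \in interp B R) ->
    (forall x, x \in free_vars phi -> g x = Some b) ->
  pp_sat g phi.
Proof.
move=> loop_b; elim: phi g => //= [R t|phi IHphi psi IHpsi|x phi IHphi] g gb.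
- exists [tuple of nseq (arity R) b] => //=.
  rewrite map_nseq -[in RHS](size_tuple t) -(size_map g); apply/all_pred1P.
  by rewrite all_map; apply/allP => x xt /=; rewrite gb // inE.
- by split; [apply: IHphi|apply: IHpsi] => x xphi; apply: gb;
    rewrite in_fsetU xphi ?orbT.
- exists b; apply: IHphi => y yphi; case: eqP => // /eqP yx.
  by apply: gb; rewrite in_fsetD1 yx.
Qed.

Lemma pp_answers_loop (X : choiceType) B (phi : pp_formula tau X)
    (S : {fset X}) : has_loop B -> free_vars phi `<=` S ->
  (0 < #|pp_answers S phi B|)%N.
Proof.
move=> [b loop_b] /fsubsetP phiS; apply/card_gt0P; exists [ffun=> b].
rewrite inE; apply/asboolP/(pp_sat_loop loop_b) => x /phiS xS.
by rewrite insubT /= ffunE.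
Qed.

(** The common value propagates along a path. Applied to the side of a disjoint union on which a
    homomorphism lands. *)
Lemma connected_eq A (T : Type) (f : A -> T) (x0 : A) : connected A ->
    (forall (R : tau) (t : (arity R).-tuple A) x y, t \in interp A R ->
      x \in t -> y \in t -> f x = f y) ->
  forall x, f x = f x0.
Proof.
move=> conA edge x; case/connectP: (conA x0 x) => p.
elim: p x0 => [|y p IHp] x0 /=; first by move=> _ ->.
move=> /andP[/andP[_ /asboolP[R [t [tA x0t yt]]]] yp] xp.
by rewrite (IHp y yp xp) (edge R t x0 y).
Qed.

End StructureOperations.

(** * Counting answers on products and disjoint unions *)

Section CountingAnswers.
Variables (tau : signature) (X : choiceType).
Implicit Types (B C : structure tau) (phi : prenex_pp tau X).

Lemma card_answers_loop phi : #|answers phi (loop_structure tau)| = 1%N.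
Proof.
have -> : answers phi (loop_structure tau) = setT.
  apply/setP => f; rewrite !inE; apply/asboolP; exists (fun=> tt).
    by move=> R t _; rewrite inE.
  by move=> x; case: (f x).
by rewrite cardsT card_ffun card_unit exp1n.
Qed.

(** A homomorphism into a product is a pair of homomorphisms, and pairing commutes with restriction
    to the liberal variables. *)
Lemma card_answers_product phi B C :
  #|answers phi (product B C)| = (#|answers phi B| * #|answers phi C|)%N.
Proof.
pose L := {x | x \in prenex_lib phi}.
pose pair_ffun (fg : {ffun L -> B} * {ffun L -> C}) : {ffun L -> product B C} :=
  [ffun x => (fg.1 x, fg.2 x)].
have pair_inj : injective pair_ffun.
  move=> [f g] [f' g'] /ffunP eqfg; congr pair; apply/ffunP => x;
    by have := eqfg x; rewrite !ffunE => -[].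
rewrite -cardsX -(card_imset _ pair_inj); apply: eq_card => /= f.
apply/idP/imsetP => [|[[g1 g2]]].
  rewrite inE => /asboolP[h homh hf].
  exists ([ffun x => (f x).1], [ffun x => (f x).2]); last first.
    by apply/ffunP => x; rewrite !ffunE; case: (f x).
  rewrite !inE; apply/andP; split; apply/asboolP.
    exists (fun x => (h x).1) => [R t /homh|x]; last by rewrite ffunE hf.
    rewrite inE => /andP[+ _]; apply: interp_val.
    by rewrite /= -map_comp.
  exists (fun x => (h x).2) => [R t /homh|x]; last by rewrite ffunE hf.
  rewrite inE => /andP[_]; apply: interp_val.
  by rewrite /= -map_comp.
rewrite !inE /= => /andP[/asboolP[h1 hom1 hg1] /asboolP[h2 hom2 hg2]] ->.
apply/asboolP; exists (fun x => (h1 x, h2 x)) => [R t tphi|x]; last first.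
  by rewrite ffunE hg1 hg2.
rewrite inE; apply/andP; split.
  move: (hom1 R t tphi); apply: interp_val.
  by rewrite /= -map_comp.
move: (hom2 R t tphi); apply: interp_val.
by rewrite /= -map_comp.
Qed.

Lemma tuple_ex_mem (T : eqType) n (t : n.-tuple T) :
  (0 < n)%N -> exists x, x \in t.
Proof. by case: n t => // n t _; exists (thead t); apply: mem_tnth. Qed.

(** A connected structure maps entirely into one summand, and the value at a liberal variable tells
    which, so no answer is counted twice. *)
Lemma card_answers_sum phi B C :
    prenex_lib phi != finset.set0 -> connected (prenex_structure phi) ->
  #|answers phi (sum_structure B C)| = (#|answers phi B| + #|answers phi C|)%N.
Proof.
move=> /set0Pn[x0 x0lib] conphi.
pose L := {x | x \in prenex_lib phi}; pose l0 : L := exist _ x0 x0lib.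
pose inl_ffun (f : {ffun L -> B}) : {ffun L -> sum_structure B C} :=
  [ffun x => inl (f x)].
pose inr_ffun (f : {ffun L -> C}) : {ffun L -> sum_structure B C} :=
  [ffun x => inr (f x)].
have inl_inj : injective inl_ffun.
  by move=> f g /ffunP fg; apply/ffunP => x; have := fg x; rewrite !ffunE => -[].
have inr_inj : injective inr_ffun.
  by move=> f g /ffunP fg; apply/ffunP => x; have := fg x; rewrite !ffunE => -[].
rewrite -(card_imset _ inl_inj) -(card_imset _ inr_inj) -cardsUI.
rewrite [X in (_ + X)%N]eq_card0 ?addn0; last first.
  move=> f; rewrite !inE; apply/negP => /andP[/imsetP[g _ ->] /imsetP[g' _]].
  by move=> /ffunP/(_ l0); rewrite !ffunE.
apply: eq_card => f; apply/idP/idP; last first.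
  rewrite in_setU => /orP[] /imsetP[g]; rewrite !inE => /asboolP[h homh hg] ->;
    apply/asboolP.
    exists (inl \o h) => [R t tphi|x]; last by rewrite ffunE /= hg.
    rewrite inE; apply/orP; left; apply/imsetP.
    exists [tuple of map h t]; first exact: homh.
    by apply: val_inj; rewrite /= map_comp.
  exists (inr \o h) => [R t tphi|x]; last by rewrite ffunE /= hg.
  rewrite inE; apply/orP; right; apply/imsetP.
  exists [tuple of map h t]; first exact: homh.
  by apply: val_inj; rewrite /= map_comp.
rewrite inE => /asboolP[h homh hf].
(* A tuple of the disjoint union lies within one summand, so the side of [h x] is constant on each
   tuple of the formula. *)
have side x : is_inl (h x) = is_inl (h x0).
  apply: (connected_eq (f := is_inl \o h) x0 conphi).
  move=> R t y z /homh tBC yt zt.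
  have : all (fun u => is_inl u) (map h t) \/ all (fun u => ~~ is_inl u) (map h t).
    move: tBC; rewrite inE => /orP[] /imsetP[u _ /(congr1 val) /= ->]; [left|right];
    by rewrite all_map; apply/allP.
  rewrite !all_map => -[] /allP ht; have := ht _ yt; have := ht _ zt => /=.
    by move=> -> ->.
  by move=> /negbTE -> /negbTE ->.
rewrite in_setU; apply/orP; case h0: (h x0) side => [b0|c0] /= side.
  (* [b0] is a mere default: by [hk] the other branch never occurs. *)
  left; apply/imsetP; pose k x := if h x is inl b then b else b0.
  have hk x : h x = inl (k x) by rewrite /k; have := side x; case: (h x).
  exists [ffun x => k (val x)]; last by apply/ffunP => x; rewrite !ffunE -hf hk.
  rewrite inE; apply/asboolP; exists k => [R t /homh|x]; last by rewrite ffunE.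
  (* Positive arity supplies an entry [y], whose image on the left excludes that the image tuple
     comes from [C]. *)
  have [y yt] := tuple_ex_mem t (arity_gt0 R).
  rewrite inE => /orP[] /imsetP[u uB /(congr1 val) /= htu].
    move: uB; apply: interp_val => /=.
    apply: (inj_map (f := @inl B C)) => [? ? []//|].
    by rewrite -htu -map_comp; apply: eq_map.
  have := map_f h yt; rewrite htu => /mapP[v _].
  by rewrite hk.
right; apply/imsetP; pose k x := if h x is inr c then c else c0.
have hk x : h x = inr (k x) by rewrite /k; have := side x; case: (h x).
exists [ffun x => k (val x)]; last by apply/ffunP => x; rewrite !ffunE -hf hk.
rewrite inE; apply/asboolP; exists k => [R t /homh|x]; last by rewrite ffunE.
have [y yt] := tuple_ex_mem t (arity_gt0 R).
rewrite inE => /orP[] /imsetP[u uB /(congr1 val) /= htu]; last first.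
  move: uB; apply: interp_val => /=.
  apply: (inj_map (f := @inr B C)) => [? ? []//|].
  by rewrite -htu -map_comp; apply: eq_map.
have := map_f h yt; rewrite htu => /mapP[v _].
by rewrite hk.
Qed.

End CountingAnswers.

(** * Count vectors, their differences, and values of component polynomials *)

Section ComponentPolynomialValues.
Local Open Scope ring_scope.
Variables (tau : signature) (X : choiceType) (V : {pred X}).
Local Notation eclass := (eclass tau V).
Implicit Types (A B C : structure tau) (e : eclass) (q : component_poly tau V).

Lemma eclass_count_product e B C :
  eclass_count e (product B C) = (eclass_count e B * eclass_count e C)%N.
Proof. exact: card_answers_product. Qed.

Lemma eclass_count_loop e : eclass_count e (loop_structure tau) = 1%N.
Proof. exact: card_answers_loop. Qed.

Lemma eclass_count_sum e B C :
  eclass_count e (sum_structure B C) = (eclass_count e B + eclass_count e C)%N.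
Proof.
have /and3P[lib_neq0 /asboolP con _] :=
  valP (repr (e : {eq_quot lc_equivR tau V})%qT).
exact: card_answers_sum.
Qed.

Lemma eclass_count_iter_sum e B C n :
  eclass_count e (iter n (sum_structure B) C) =
  (n * eclass_count e B + eclass_count e C)%N.
Proof. by elim: n => //= n IHn; rewrite eclass_count_sum IHn mulSn addnA. Qed.

Lemma eclass_count_separates e e' : e != e' ->
  exists B, eclass_count e B != eclass_count e' B.
Proof.
move=> /eqP ee'; apply: contrapT => /forallNP same; apply: ee'.
rewrite -[e]reprK -[e']reprK; apply/eqmodP/asboolP => B.
by apply/eqP/negPn/negP/same.
Qed.

Lemma cp_evalE q B :
  cp_eval q B = meval q (fun e => (eclass_count e B)%:Z).
Proof. by apply: eq_bigr => m _; rewrite intz. Qed.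

(** The pair [B], [C] acts as a formal difference of structures, which makes negative values
    available. *)
Definition count_diff (f : eclass -> int) : Prop :=
  exists B C, forall e, f e = (eclass_count e B)%:Z - (eclass_count e C)%:Z.

Lemma count_diff_cst (z : int) : count_diff (fun=> z).
Proof.
pose L := loop_structure tau; case: z => n.
  (* Each copy of [L] adds 1 to every count; the subtracted [L] cancels the one that starts the
     iteration. *)
  exists (iter n (sum_structure L) L), L => e.
  by rewrite eclass_count_iter_sum eclass_count_loop muln1 PoszD addrK.
exists L, (iter n.+1 (sum_structure L) L) => e.
rewrite eclass_count_iter_sum eclass_count_loop muln1 PoszD.
by rewrite NegzE opprD addrCA subrr addr0.
Qed.

Lemma count_diffD f g :
  count_diff f -> count_diff g -> count_diff (fun e => f e + g e).
Proof.
move=> [B [C fE]] [B' [C' gE]].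
exists (sum_structure B B'), (sum_structure C C') => e.
by rewrite fE gE !eclass_count_sum !PoszD opprD addrACA.
Qed.

Lemma count_diffM f g :
  count_diff f -> count_diff g -> count_diff (fun e => f e * g e).
Proof.
move=> [B [C fE]] [B' [C' gE]].
exists (sum_structure (product B B') (product C C')),
  (sum_structure (product B C') (product C B')) => e.
rewrite fE gE !eclass_count_sum !eclass_count_product !PoszD !PoszM.
by ring.
Qed.

Lemma count_diff_count B : count_diff (fun e => (eclass_count e B)%:Z).
Proof.
exists (sum_structure B (loop_structure tau)), (loop_structure tau) => e.
by rewrite eclass_count_sum PoszD addrK.
Qed.

Lemma count_diff_sum (T : Type) (r : seq T) (F : T -> eclass -> int) :
  (forall i, count_diff (F i)) -> count_diff (fun e => \sum_(i <- r) F i e).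
Proof.
move=> Fdiff; elim: r => [|i r IHr].
  by under eq_fun do rewrite big_nil; apply: count_diff_cst.
by under eq_fun do rewrite big_cons; apply: count_diffD.
Qed.

Lemma count_diff_prod (T : Type) (r : seq T) (F : T -> eclass -> int) :
  (forall i, count_diff (F i)) -> count_diff (fun e => \prod_(i <- r) F i e).
Proof.
move=> Fdiff; elim: r => [|i r IHr].
  by under eq_fun do rewrite big_nil; apply: count_diff_cst.
by under eq_fun do rewrite big_cons; apply: count_diffM.
Qed.

(** The numerator of Lagrange interpolation: for each [i] in [s] other than [e0], a structure [B i]
    on which [i] and [e0] have different counts gives a factor that vanishes at [i] but not at [e0].
    Without division the value at [e0] is only nonzero, not 1. *)
Lemma count_diff_delta (s : {fset eclass}) e0 :
  exists f, [/\ count_diff f, f e0 != 0 &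
    {in s, forall e, e != e0 -> f e = 0}].
Proof.
have /choice[B sepB] e : exists B, e != e0 ->
    eclass_count e0 B != eclass_count e B.
  have [->|ee0] := eqVneq e e0; first by exists (loop_structure tau).
  by have [B ?] := eclass_count_separates ee0; exists B; rewrite eq_sym.
exists (fun e => \prod_(i <- s `\ e0)
  ((eclass_count e (B i))%:Z + - (eclass_count i (B i))%:Z)); split.
- apply: count_diff_prod => i; apply: count_diffD; first exact: count_diff_count.
  exact: count_diff_cst.
- rewrite prodf_seq_neq0; apply/allP => i; rewrite in_fsetD1 => /andP[ie0 _] /=.
  by rewrite subr_eq0 eqz_nat sepB.
- move=> e es ee0; rewrite (big_fsetD1 e) /=; last by rewrite in_fsetD1 ee0.
  by rewrite subrr mul0r.
Qed.

(* The value at [P + L + t (N + L)], [L] being a looped point, is a polynomial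
   in [t]: vanishing at every natural [t], it also vanishes at [t = -1]. *)
Lemma meval_count_diff_eq0 q (a f : eclass -> int) :
    (forall E, has_loop E ->
      meval q (fun e => a e * (eclass_count e E)%:Z) = 0) ->
  count_diff f -> meval q (fun e => a e * f e) = 0.
Proof.
move=> q0 [P [N fE]]; pose L := loop_structure tau.
pose E n := iter n (sum_structure (sum_structure N L)) (sum_structure P L).
(* The [L] next to [P] provides a loop already for [n = 0]. *)
have loopE n : has_loop (E n).
  by elim: n => [|n IHn]; apply: has_loop_sumr => //; apply: has_loop_loop.
pose c B e := (eclass_count e B)%:Z.
pose p e := (a e)%:P * ((c P e + 1)%:P + (c N e + 1)%:P * 'X).
have pE e t : (p e).[t] = a e * ((c P e + 1) + (c N e + 1) * t).
  by rewrite !hornerE.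
have p0 : meval q p = 0.
  apply: poly_int_nat_roots => n; rewrite horner_meval -[RHS](q0 (E n)) //.
  apply: eq_meval => m e _ _; rewrite pE eclass_count_iter_sum !eclass_count_sum.
  by rewrite eclass_count_loop PoszD PoszM !PoszD addrC [_ * n%:Z]mulrC.
(* At [t = -1] the contributions of the two copies of [L] cancel, leaving the counts of [P] minus
   those of [N], that is [f]. *)
have := congr1 (horner^~ (-1)) p0; rewrite /= horner0 horner_meval => <-.
apply: eq_meval => m e _ _; rewrite pE fE mulrN1 opprD addrACA.
by rewrite subrr addr0.
Qed.

(** The weights [a] stand for the counts on [A]. If [q] vanished for every looped [E], it would
    vanish at all integer combinations of the interpolating vectors [d i], against the non-vanishing
    of [q] on rescaled integer points. *)
Lemma exists_loop_meval_neq0 q (a : eclass -> int) : q != 0 ->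
    {in cp_vars q, forall e, a e != 0} ->
  exists2 E, has_loop E & meval q (fun e => a e * (eclass_count e E)%:Z) != 0.
Proof.
move=> q_neq0 a_neq0; apply: contrapT => /forall2NP noE.
have q0 E : has_loop E -> meval q (fun e => a e * (eclass_count e E)%:Z) = 0.
  by move=> loopE; have [//|/negP/negPn/eqP] := noE E.
have /choice[d dP] := count_diff_delta (cp_vars q).
have varsq m e : m \in msupp q -> e \in finsupp (cmonom_val m) -> e \in cp_vars q.
  by move=> mq em; apply/imfset2P; exists m => //; exists e.
(* The scale [a e * d e e] is the one that the combination with coefficients [x] produces at
   coordinate [e], since [d i] vanishes there for the other [i]. *)
have [|||x] := @meval_neq0 _ q (cp_vars q) (fun e => a e * d e e) => //.
- by move=> m mq; apply/fsubsetP => e; apply: varsq.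
- by move=> e eq; have [_ de _] := dP e; rewrite mulf_neq0 ?a_neq0.
case/eqP; have xd : count_diff (fun e => \sum_(i <- cp_vars q) x i * d i e).
  apply: count_diff_sum => i; have [di _ _] := dP i.
  by apply: count_diffM => //; apply: count_diff_cst.
rewrite -[RHS](meval_count_diff_eq0 q0 xd); apply: eq_meval => m e mq em.
have eq := varsq m e mq em.
rewrite (big_fsetD1 e) //= big_seq big1 ?addr0 -?mulrA 1?[d e e * _]mulrC //.
move=> i; rewrite in_fsetD1 => /andP[ie _]; have [_ _ di] := dP i.
by rewrite di ?mulr0 // eq_sym.
Qed.

Lemma exists_loop_cp_eval_product_neq0 q A : q != 0 ->
    {in cp_vars q, forall e, (0 < eclass_count e A)%N} ->
  exists2 E, has_loop E & cp_eval q (product A E) != 0.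
Proof.
move=> q_neq0 A_gt0.
have [|E loopE qE] :=
    @exists_loop_meval_neq0 q (fun e => (eclass_count e A)%:Z) q_neq0.
  by move=> e /A_gt0; rewrite lt0n.
exists E => //; rewrite cp_evalE; move: qE; congr (_ != _).
by apply: eq_meval => m e _ _; rewrite eclass_count_product PoszM.
Qed.

End ComponentPolynomialValues.

Theorem theorem5p4 (tau : signature) (X : choiceType) (V : {pred X})
    (q : component_poly tau V) (q_neq0 : q != 0) :
  (exists B : structure tau, cp_eval q B != 0) /\
  (forall (n : nat) (phi : 'I_n -> lc_formula tau V)
      (phi_vars : cp_vars q =i codom (fun i => class_of (phi i)))
      (A : structure tau)
      (A_pos : forall i : 'I_n, (0 < #|answers (val (phi i)) A|)%N),
    exists E : structure tau,
      (forall (psi : pp_formula tau X) (S : {fset X}),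
          free_vars psi `<=` S -> (0 < #|pp_answers S psi E|)%N) /\
      cp_eval q (product A E) != 0).
Proof.
split.
  (* The looped point serves as [A], since all its counts are 1. *)
  have [|E _ qE] :=
      @exists_loop_cp_eval_product_neq0 _ _ _ q (loop_structure tau) q_neq0.
    by move=> e _; rewrite eclass_count_loop.
  by exists (product (loop_structure tau) E).
move=> n phi phi_vars A A_pos.
have [|E loopE qE] := @exists_loop_cp_eval_product_neq0 _ _ _ q A q_neq0.
  by move=> e; rewrite phi_vars => /codomP[i ->]; rewrite eclass_countE.
by exists E; split=> // psi S; apply: pp_answers_loop.
Qed.
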